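(* Let $X=(X(t))_{t\in\mathbb{R}}$ be the positive supOU process with characteristics $\pi$ and $\lambda$ (as defined in the context). Assume that $\int_{(0,1]} z\,\lambda(\mathrm{d}z)<\infty$, $m_0(\pi)=\pi((0,\infty))<\infty$, that $\overline{\lambda}$ is dominatedly varying, and that for some $c>1$ $$\limsup_{r\to\infty}\frac{\overline{\lambda}(cr)}{\overline{\lambda}(r)}<1.$$ Let $f:[1,\infty)\to\mathbb{R}$ be a differentiable (strictly) increasing function tending to infinity, with $f(1)>0$, whose inverse $f^{\leftarrow}$ is submultiplicative. Then: - if $\int_1^\infty\overline{\lambda}(f(t))\,\mathrm{d}t<\infty$, then $\limsup_{t\to\infty}\dfrac{X(t)}{f(t)}=0$ almost surely; - if $\int_1^\infty\overline{\lambda}(f(t))\,\mathrm{d}t=\infty$, then $\limsup_{t\to\infty}\dfrac{X(t)}{f(t)}=\infty$ almost surely.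
   Context: For a measure $Q$ on $(0,\infty)$ write $m_p(Q)=\int_{(0,\infty)}x^p\,Q(\mathrm{d}x)$ and $\overline{Q}(x)=Q((x,\infty))$ for $x>0$. Setting: $\pi$ is a nonzero measure on $(0,\infty)$ with $m_{-1}(\pi)=\int_{(0,\infty)}x^{-1}\pi(\mathrm{d}x)<\infty$. $\lambda$ is a Lévy measure on $(0,\infty)$, i.e. $\int_{(0,\infty)}(1\wedge z^2)\lambda(\mathrm{d}z)<\infty$, satisfying $\int_{(1,\infty)}\log z\,\lambda(\mathrm{d}z)<\infty$. $\mu$ is a Poisson random measure on $(0,\infty)\times\mathbb{R}\times(0,\infty)$ with intensity measure $\nu(\mathrm{d}x,\mathrm{d}s,\mathrm{d}z)=\pi(\mathrm{d}x)\,\mathrm{d}s\,\lambda(\mathrm{d}z)$, with points $(\xi_k,\tau_k,\zeta_k)_{k\ge 0}$. When $\int_{(0,1]}z\,\lambda(\mathrm{d}z)<\infty$, the positive supOU process (drift chosen so that there is no centering) is $$X(t)=\sum_{k:\tau_k\le t}e^{-\xi_k(t-\tau_k)}\zeta_k,\qquad t\in\mathbb{R}.$$ A nonincreasing (eventually positive-valued, i.e. never vanishing) function $h$ on $(0,\infty)$ is dominatedly varying if $\limsup_{x\to\infty}h(x)/h(2x)<\infty$. A function $g$ is submultiplicative if there exists $a>0$ such that $g(x+y)\le a\,g(x)g(y)$ for all $x,y$ (for $f^{\leftarrow}$: for all $x,y$ in its domain $[f(1),\infty)$). *)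

(* Defs.v *)
From HB Require Import structures.
From mathcomp Require Export all_boot all_order all_algebra.
From mathcomp Require Export all_classical all_reals all_analysis.
From mathcomp Require Export measurable_realfun.

Set Implicit Arguments.
Unset Strict Implicit.
Unset Printing Implicit Defensive.

Import Order.TTheory GRing.Theory Num.Theory.
Import numFieldNormedType.Exports.

Local Open Scope classical_set_scope.
Local Open Scope ring_scope.

Section measures_on_the_half_line.
Context {R : realType}.
Implicit Types (Q : {measure set (measurableTypeR R) -> \bar R}) (h : R -> R).

(* A measure on (0, oo) is represented by a measure on the whole line that
   does not charge its complement. *)
Definition on_pos_half_line Q := Q `]-oo, 0]%classic = 0%E.

Definition moment Q (p : R) : \bar R :=
  (\int[Q]_(x in `]0%R, +oo[) (x `^ p)%:E)%E.

Definition tail Q (x : R) : \bar R := Q `]x, +oo[%classic.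

Definition levy_measure Q :=
  on_pos_half_line Q /\
  (\int[Q]_(z in `]0%R, +oo[) (Num.min 1 (z ^+ 2))%:E < +oo)%E.

Definition dominatedly_varying h :=
  [/\ forall x y, 0 < x -> x <= y -> h y <= h x,
      forall x, 0 < x -> 0 < h x &
      (limf_esup (fun x => (h x / h (2 * x))%:E) +oo%R < +oo)%E].

End measures_on_the_half_line.

Section poisson_random_measures.
Context {R : realType} {d d' : measure_display}.
Context {Omega : measurableType d} {S : measurableType d'}.
Variable P : probability Omega R.

(* Some of the B i may be the whole of \bar R, so that the product rule for
   all subfamilies is included. *)
Definition mutually_independent (I : finType) (Y : I -> Omega -> \bar R) :=
  forall B : I -> set (\bar R), (forall i, measurable (B i)) ->
    P (\bigcap_(i in [set: I]) Y i @^-1` B i) =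
    (\prod_(i : I) P (Y i @^-1` B i))%E.

(* The intensity nu is a bare set function: for the product set function used
   below to be a measure, the last factor has to be sigma-finite, which is a
   consequence of the Levy condition and not part of the type.
   The Poisson weights are written out because poisson_pmf is constantly 1 at
   rate 0, whereas here the rate 0 has to give the Dirac mass at 0. *)
Definition poisson_random_measure (nu : set S -> \bar R)
    (mu : Omega -> {measure set S -> \bar R}) :=
  [/\ forall A, measurable A -> measurable_fun [set: Omega] (mu ^~ A),
      forall A, measurable A -> (nu A < +oo)%E -> forall k : nat,
        P [set w | mu w A = k%:R%:E] =
        (fine (nu A) ^+ k / k`!%:R * expR (- fine (nu A)))%:E,
      forall A, measurable A -> nu A = +oo%E ->
        {ae P, forall w, mu w A = +oo%E} &
      forall (n : nat) (A : 'I_n -> set S), (forall i, measurable (A i)) ->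
        trivIset [set: 'I_n] A ->
        mutually_independent (fun i w => mu w (A i))].

Definition point_measure (p : nat -> Omega -> S) (w : Omega)
    : {measure set S -> \bar R} :=
  mseries (fun k => \d_(p k w)) 0.

End poisson_random_measures.

Section supOU.
Context {R : realType} {d : measure_display} {Omega : measurableType d}.

(* The points are required to lie in (0, oo) x R x (0, oo), so that all terms
   of the series defining the process are positive. *)
Definition supOU_points (P : probability Omega R)
    (pi lambda : {measure set (measurableTypeR R) -> \bar R})
    (xi tau zeta : nat -> {RV P >-> R}) :=
  (forall k w, 0 < xi k w /\ 0 < zeta k w) /\
  poisson_random_measure P (pi \x lebesgue_measure \x lambda)%E
    (point_measure
      (fun k w => (xi k w, tau k w, zeta k w)
         : measurableTypeR R * measurableTypeR R * measurableTypeR R)).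

Definition supOU (xi tau zeta : nat -> Omega -> R) (t : R) (w : Omega)
    : \bar R :=
  (\sum_(k <oo | (tau k w <= t)%R)
     (expR (- xi k w * (t - tau k w)) * zeta k w)%:E)%E.

End supOU.

Section real_functions.
Context {R : realType}.
Implicit Types (D : set R) (f g : R -> R).

(* Limits of difference quotients are taken within D: at an endpoint of an
   interval D the derivative is one-sided. *)
Definition differentiable_within D f :=
  forall t, D t -> cvg ((f s - f t) / (s - t) @[s --> within D t^']).

Definition submultiplicative_on D g :=
  exists2 a : R, 0 < a &
    forall x y, D x -> D y -> g (x + y) <= a * g x * g y.

End real_functions.

(* Main.v *)
From HB Require Import structures.
Require Import Defs.
From mathcomp Require Import all_boot all_order all_algebra.
From mathcomp Require Import all_classical all_reals all_analysis.
From mathcomp Require Import measurable_realfun.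
From mathcomp Require Import ring lra.

Set Implicit Arguments.
Unset Strict Implicit.
Unset Printing Implicit Defensive.

Import Order.TTheory GRing.Theory Num.Theory.
Import numFieldNormedType.Exports.

Local Open Scope classical_set_scope.
Local Open Scope ring_scope.

(** Write L for the tail of lambda and c for the ratio in the tail condition.

If the integral of L(f(t)) diverges, only single jumps matter: a jump of size
z at time s makes X(s) at least z.  The mean number of jumps with s > N and
z > K f(s) is a multiple of the integral of L(K f(t)) over (N, oo), which is
infinite because L(K r) >= kappa L(r) by dominated variation.  So almost
surely such jumps exist for every K and N ([supOU_frequently_ge]).

If the integral converges, the point is the uniform tail estimate
[supOU_unit_interval_tail]: the probability that X exceeds C0 r somewhere on
[t, t + 1) is at most C1 L(r).  Borel-Cantelli, applied on [n, n + 1) with r of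
the order of e f(n) / C0, then gives X <= e f eventually
([supOU_eventually_le]), since L(r) <= B L(f(n)) by dominated variation and the
sum of the L(f(n)) is comparable with the integral.

For the estimate, the discount factor exp(-x (u - s)) of a point (x, s, z) is
rounded up, uniformly in u on [t, t + 1), to the power c^-j for which
x max(t - s, 0) lies in [j ln c, (j + 1) ln c).  The plane regions with a given
j, the slabs, all have mass at most M = m_0(pi) + ln c m_(-1)(pi) for pi times
Lebesgue measure.  Hence X is dominated on [t, t + 1) by the sum of the rounded
values v = c^-j z, and the mean number of points with v > r is at most
M (L(r) + L(c r) + ...) <= C L(r), as L(c r) <= rho L(r) with rho < 1.

The values v <= r are grouped in the bands r c^-(l+1) < v <= r c^-l.  Band l
contains a Poisson number of points of mean m_l <= M L(r c^-(l+1)), so it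
contributes its mean, up to constants, unless a Poisson variable is atypically
large.  On the grid r = r0 c^n, the weighted sum of the L(r c^-(l+1)) with
weights c^-l is at most A sigma^n for some sigma < 1
([geometric_tail_sum_decay]); here finiteness is the integrability of small
jumps and decay is the ratio condition.  This leaves room for a Chernoff bound
with the tilt exp(theta) = sigma^-n: the thresholds m_l exp(theta) + q + l, the
first term being up to a constant factor, still sum up to a multiple of r, and
band l exceeds its threshold with probability at most sigma^(n q + l).
Dominated variation gives L(r0 c^n) >= kappa^n L(r0), so choosing q with
sigma^q <= kappa makes the sum over l of these probabilities of order L(r). *)

(** * Upper limits at infinity *)

Section limsup_at_infinity.
Context {R : realType}.
Implicit Types (g : R -> \bar R) (y : \bar R).

Lemma limf_esup_lt g y : (limf_esup g +oo%R < y)%E ->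
  exists2 s, (s < y)%E & exists M : R, forall x, M < x -> (g x <= s)%E.
Proof.
rewrite limf_esupE => /ereal_inf_lt [_ [V [M [_ MV]] <-] Vy].
exists (ereal_sup (g @` V)) => //; exists M => x Mx.
by apply: ereal_sup_ubound; exists x => //; exact: MV.
Qed.

Lemma limf_esup_eq0 g :
  (forall e, 0 < e ->
     exists M : R, forall x, M < x -> (0 <= g x <= e%:E)%E) ->
  limf_esup g +oo%R = 0%E.
Proof.
move=> H; rewrite limf_esupE; apply/eqP; rewrite eq_le; apply/andP; split.
  apply/lee_addgt0Pr => e e0; rewrite add0e.
  have [M HM] := H _ e0.
  apply: (@le_trans _ _ (ereal_sup (g @` [set x | M < x]))).
    apply: ereal_inf_lbound; exists [set x | M < x] => //.
    by exists M; split => //; exact: num_real.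
  by apply: ge_ereal_sup => _ [x Mx <-]; have /andP[] := HM _ Mx.
apply: le_ereal_inf_tmp => _ [V [M [_ MV]] <-].
have [M' HM'] := H _ ltr01.
have Mx : M < Num.max M M' + 1 by rewrite ltr_pwDr// le_max lexx.
have M'x : M' < Num.max M M' + 1 by rewrite ltr_pwDr// le_max lexx orbT.
have /andP[g0 _] := HM' _ M'x; apply: (le_trans g0).
by apply: ereal_sup_ubound; exists (Num.max M M' + 1) => //; exact: MV.
Qed.

Lemma limf_esup_eqy g :
  (forall K M : R, exists2 x, M < x & (K%:E <= g x)%E) ->
  limf_esup g +oo%R = +oo%E.
Proof.
move=> H; rewrite limf_esupE; apply/eqyP => K _.
apply: le_ereal_inf_tmp => _ [V [M [_ MV]] <-].
have [x Mx Kx] := H K M; apply: (le_trans Kx).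
by apply: ereal_sup_ubound; exists x => //; exact: MV.
Qed.

End limsup_at_infinity.

(** * Poisson tails *)

Lemma nneseries_expR {R : realType} (x : R) :
  (\sum_(k <oo) (x ^+ k / k`!%:R)%:E = (expR x)%:E)%E.
Proof.
rewrite /expR -EFin_lim; last exact: is_cvg_series_exp_coeff.
by apply/congr_lim/funext => n /=; rewrite /series/= -sumEFin.
Qed.

Section poisson_tails.
Context {R : realType} {d : measure_display} {Omega : measurableType d}.
Variables (P : probability Omega R) (N : Omega -> \bar R) (m : R).
Hypothesis mN : measurable_fun [set: Omega] N.
Hypothesis m0 : 0 <= m.
Hypothesis PN : forall k : nat,
  P [set w | N w = k%:R%:E] = (m ^+ k / k`!%:R * expR (- m))%:E.

Let measurable_level (k : nat) : measurable [set w | N w = k%:R%:E].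
Proof.
rewrite -[X in measurable X]setTI (_ : [set w | _] = N @^-1` [set k%:R%:E])//.
exact: mN.
Qed.

Lemma measurable_ge_level (y : R) : measurable [set w | (y%:E <= N w)%E].
Proof.
rewrite -[X in measurable X]setTI.
rewrite (_ : [set w | _] = N @^-1` `[y%:E, +oo[); last first.
  by apply/seteqP; split => w /=; rewrite in_itv/= andbT.
by apply: mN => //; exact: emeasurable_itv.
Qed.

(* The Poisson weights sum up to 1, so N is almost surely a natural number. *)
Let levels_full : P (~` \bigcup_k [set w | N w = k%:R%:E]) = 0%E.
Proof.
rewrite probability_setC; last exact: bigcupT_measurable.
rewrite measure_semi_bigcup//; last 2 first.
- move=> i j _ _ [w [Ni Nj]].
  by apply/eqP; rewrite -(eqr_nat R); apply/eqP; move: Nj; rewrite /= Ni => -[].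
- exact: bigcupT_measurable.
rewrite (eq_eseriesr (g := fun k => ((expR (- m))%:E * (m ^+ k / k`!%:R)%:E)%E)).
  rewrite nneseriesZl//; last by move=> k _; rewrite lee_fin divr_ge0// exprn_ge0.
  by rewrite nneseries_expR -EFinM -expRD addNr expR0 subee.
by move=> k _; rewrite -EFinM mulrC; exact: PN.
Qed.

(** Exponential Markov inequality, summed over the levels of N; the factor
    exp(- m) of the moment generating function is bounded by 1. *)
Lemma poisson_chernoff (t y : R) : 0 <= t ->
  (P [set w | (y%:E <= N w)%E] <= (expR (m * expR t - t * y))%:E)%E.
Proof.
move=> t0; set A := [set w | _]; pose E k := [set w | N w = k%:R%:E].
have mA : measurable A := measurable_ge_level y.
have mU : measurable (\bigcup_k E k) by apply: bigcupT_measurable => k; exact: measurable_level.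
have mAE k : measurable (A `&` E k) by apply: measurableI => //; exact: measurable_level.
rewrite -(setDUK (A := A `&` (\bigcup_k E k)) (B := A))//.
have -> : P ((A `&` \bigcup_k E k) `|` (A `\` (A `&` \bigcup_k E k)))
        = P (A `&` \bigcup_k E k).
  apply: measureU0 => //; [exact: measurableI|by apply: measurableD => //; exact: measurableI|].
  apply/eqP; rewrite -measure_le0 -levels_full.
  apply: le_measure; rewrite ?inE.
  - by apply: measurableD => //; exact: measurableI.
  - exact: measurableC.
  by move=> w [Aw nAU] Uw; apply: nAU.
rewrite setI_bigcupr measure_semi_bigcup//; last 2 first.
- move=> i j _ _ [w [[_ Ni] [_ Nj]]].
  apply/eqP; rewrite -(eqr_nat R); apply/eqP.
  by case: (etrans (esym Ni) Nj : i%:R%:E = j%:R%:E :> \bar R).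
- exact: bigcupT_measurable.
apply: (@le_trans _ _ (\sum_(k <oo) ((expR (- t * y - m))%:E *
    ((m * expR t) ^+ k / k`!%:R)%:E))%E).
  apply: lee_nneseries => [//|k _].
  have [yk|ky] := leP y k%:R; last first.
    rewrite (_ : A `&` E k = set0) ?measure0.
      by rewrite -EFinM lee_fin mulr_ge0 ?expR_ge0// divr_ge0// exprn_ge0// mulr_ge0 ?expR_ge0.
    by apply/seteqP; split => // w [/=]; rewrite /A/E /= => + Nw; rewrite Nw lee_fin leNgt ky.
  apply: (@le_trans _ _ (P (E k))).
    apply: le_measure; rewrite ?inE; [exact: mAE|exact: measurable_level|].
    exact: subIsetr.
  rewrite PN -EFinM lee_fin exprMn -expRM_natl.
  rewrite (_ : expR _ * _ = (m ^+ k / k`!%:R * expR (- m)) * expR (k%:R * t - t * y)).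
    rewrite ler_peMr// ?mulr_ge0 ?expR_ge0// ?divr_ge0 ?exprn_ge0//.
    by rewrite -[leLHS]expR0 ler_expR [k%:R * t]mulrC -mulrBr mulr_ge0// subr_ge0.
  rewrite (_ : - t * y - m = - m + (- (t * y))) ?expRD; last by ring.
  ring.
rewrite nneseriesZl//; last first.
  by move=> k _; rewrite lee_fin divr_ge0// exprn_ge0// mulr_ge0// expR_ge0.
rewrite nneseries_expR -EFinM lee_fin -expRD ler_expR mulNr.
by rewrite addrC addrA lerBlDr lerDl.
Qed.

Lemma poisson_gt0 : (P [set w | N w <> 0%E] <= m%:E)%E.
Proof.
rewrite (_ : [set w | _] = ~` [set w | N w = 0%:R%:E])//.
rewrite probability_setC// PN expr0 mul1r invr1 mul1r lee_fin.
by have := expR_ge1Dx (- m); lra.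
Qed.

End poisson_tails.

(** * Measures and their tails *)

Section product_with_sigma_finite_factor.
Context {R : realType} {d1 d2 : measure_display}.
Context {T1 : measurableType d1} {T2 : measurableType d2}.

Variables (m1 : {measure set T1 -> \bar R}) (m2 : {measure set T2 -> \bar R}).
Hypothesis sf : sigma_finite setT m2.

Let m2' : set T2 -> \bar R := m2.

HB.instance Definition _ := Measure.on m2'.
HB.instance Definition _ := Measure_isSigmaFinite.Build _ _ _ m2' sf.

(** The product set function is a measure when m2 carries a sigma-finite
    structure; m2' is m2 with this structure. *)
Lemma product_measure_exists :
  exists nu : {measure set (T1 * T2) -> \bar R},
    (forall A, nu A = (m1 \x m2)%E A) /\
    forall A B, measurable A -> measurable B ->
      nu (A `*` B) = (m1 A * m2 B)%E.
Proof.
exists (m1 \x m2')%E; split=> [A|A B mA mB]; first by [].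
exact: (product_measure1E m1 m2' mA mB).
Qed.

End product_with_sigma_finite_factor.

Section chebyshev.
Context {R : realType} {d : measure_display} {T : measurableType d}.
Variable mu : {measure set T -> \bar R}.

Lemma cst_mul_measure_le_integral (D A : set T) (f : T -> \bar R) (a : R) :
  measurable D -> measurable A -> A `<=` D -> 0 <= a ->
  measurable_fun D f -> (forall x, D x -> 0 <= f x)%E ->
  (forall x, A x -> a%:E <= f x)%E ->
  (a%:E * mu A <= \int[mu]_(x in D) f x)%E.
Proof.
move=> mD mA AD a0 mf f0 af; rewrite -integral_cst//.
apply: (@le_trans _ _ (\int[mu]_(x in A) f x)%E).
  by apply: ge0_le_integral => //; exact: measurable_funS mf.
exact: ge0_subset_integral.
Qed.

End chebyshev.

Section tails.
Context {R : realType}.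
Variable lambda : {measure set (measurableTypeR R) -> \bar R}.
Hypothesis levy : levy_measure lambda.
Implicit Types x y : R.

Lemma tail_fin x : 0 < x -> (tail lambda x < +oo)%E.
Proof.
move=> x0; have [_ fin] := levy.
pose a := Num.min 1 (x ^+ 2).
have a0 : 0 < a by rewrite lt_min ltr01 exprn_gt0.
have [mass|] := leP +oo%E (tail lambda x); last by [].
suff : (a%:E * tail lambda x <=
    \int[lambda]_(z in `]0%R, +oo[) (Num.min 1 (z ^+ 2))%:E)%E.
  move: mass; rewrite leye_eq => /eqP ->.
  by rewrite gt0_muley ?lte_fin// leye_eq => /eqP fE; rewrite fE in fin.
apply: cst_mul_measure_le_integral => //.
- by apply: subset_itvr; rewrite bnd_simp ltW.
- exact: ltW.
- apply/measurable_EFinP; apply: measurable_funTS.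
  by apply: measurable_minr => //; exact: exprn_measurable.
- by move=> z _; rewrite lee_fin le_min ler01 sqr_ge0.
- move=> z /=; rewrite in_itv/= andbT => xz; rewrite lee_fin /a.
  rewrite le_min ge_min lexx/= ge_min; apply/orP; right.
  by rewrite ler_sqr ?nnegrE ?ltW// (lt_trans x0).
Qed.

Lemma tail_fin_num x : 0 < x -> tail lambda x \is a fin_num.
Proof. by move=> x0; rewrite ge0_fin_numE ?tail_fin// measure_ge0. Qed.

Lemma tail_le x y : x <= y -> (tail lambda y <= tail lambda x)%E.
Proof.
move=> xy; apply: le_measure; rewrite ?inE//.
by apply: subset_itvr; rewrite bnd_simp.
Qed.

Lemma levy_sigma_finite : sigma_finite setT lambda.
Proof.
exists (fun n => `]-oo, 0] `|` `]n.+1%:R^-1, +oo[).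
  apply/seteqP; split => // x _.
  have [x0|x0] := leP x 0; first by exists 0%N => //; left; rewrite /= in_itv.
  exists (Num.truncn x^-1) => //; right; rewrite /= in_itv/= andbT.
  by rewrite invf_plt ?posrE// truncnS_gt.
move=> n; split; first exact: measurableU.
apply: (le_lt_trans (measureU2 _ _ _)) => //.
by rewrite [X in (X + _)%E](proj1 levy) add0e; exact: tail_fin.
Qed.

Lemma tail_band x y : x <= y ->
  tail lambda x = (lambda `]x, y]%classic + tail lambda y)%E.
Proof.
move=> xy; rewrite /tail -measureU//.
- congr (lambda _); rewrite -itv_bndbnd_setU// bnd_simp//.
- apply/seteqP; split => // z [] /=; rewrite !in_itv/= andbT => /andP[_ zy].
  by rewrite ltNge zy.
Qed.

End tails.

(** * Regular variation on a geometric grid *)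

Section regular_tails.
Context {R : realType}.
Implicit Types (h : R -> R) (r : R).

(** The doubling bound, iterated up to 2^n >= K, controls any scale K. *)
Lemma dominatedly_varying_scale h (K : R) : 0 < K -> dominatedly_varying h ->
  exists2 kappa, 0 < kappa <= 1 &
    exists2 r0, 0 < r0 & forall r, r0 <= r -> kappa * h r <= h (K * r).
Proof.
move=> K0 [hni hpos /limf_esup_lt[s soo [M HM]]].
pose r1 := Num.max M 0 + 1.
have r1M : M < r1 by rewrite ltr_pwDr// le_max lexx.
have r10 : 0 < r1 by rewrite ltr_pwDr// le_max lexx orbT.
have sfin : s \is a fin_num.
  by rewrite fin_real// soo andbT (lt_le_trans _ (HM _ r1M)) ?ltNyr.
have [B B1 HB] : exists2 B : R, 1 <= B & forall r, r1 <= r -> h r <= B * h (2 * r).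
  exists (Num.max 1 (fine s)); first by rewrite le_max lexx.
  move=> r r1r; have r0 : 0 < r by apply: lt_le_trans r1r.
  rewrite -ler_pdivrMr ?hpos ?mulr_gt0// le_max; apply/orP; right.
  by rewrite -lee_fin fineK//; apply: HM; apply: lt_le_trans r1r.
have B0 : 0 < B by apply: lt_le_trans B1.
have iter n r : r1 <= r -> B ^- n * h r <= h (2 ^+ n * r).
  elim: n r => [|n IH] r r1r; first by rewrite !expr0 invr1 !mul1r.
  have r0 : 0 < r by apply: lt_le_trans r1r.
  apply: (@le_trans _ _ (B ^- n * h (2 * r))).
    rewrite exprSr invfM -mulrA ler_wpM2l ?invr_ge0 ?exprn_ge0 ?(ltW B0)//.
    by rewrite mulrC ler_pdivrMr// mulrC HB.
  rewrite exprSr -mulrA IH//.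
  by rewrite (le_trans r1r)// ler_peMl ?(ltW r0)// ler1n.
pose n := Num.truncn K.
exists (B ^- n.+1).
  by rewrite invr_gt0 exprn_gt0//= invf_le1 ?exprn_gt0// exprn_ege1.
exists (Num.max r1 1); first by rewrite lt_max r10.
move=> r; rewrite ge_max => /andP[r1r r1'].
have r0 : 0 < r by apply: lt_le_trans r1r.
apply: (le_trans (iter _ _ r1r)).
apply: hni; first by rewrite mulr_gt0.
rewrite ler_pM2r// (le_trans (ltW (truncnS_gt _)))// -natrX ler_nat.
exact/ltnW/ltn_expl.
Qed.

Lemma tail_ratio_lt1 h c : 0 < c -> (forall x, 0 < x -> 0 < h x) ->
  (limf_esup (fun r => (h (c * r) / h r)%:E) +oo%R < 1)%E ->
  exists2 rho, 0 < rho < 1 &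
    exists2 r0, 0 < r0 & forall r, r0 <= r -> h (c * r) <= rho * h r.
Proof.
move=> c0 hpos /limf_esup_lt[s s1 [M HM]].
pose r1 := Num.max M 0 + 1.
have r1M : M < r1 by rewrite ltr_pwDr// le_max lexx.
have r10 : 0 < r1 by rewrite ltr_pwDr// le_max lexx orbT.
have sfin : s \is a fin_num.
  rewrite fin_real// (lt_trans s1) ?ltry// andbT.
  by rewrite (lt_le_trans _ (HM _ r1M)) ?ltNyr.
have bound r : r1 <= r -> h (c * r) / h r <= fine s.
  by move=> r1r; rewrite -lee_fin fineK//; apply: HM; apply: lt_le_trans r1r.
have s0 : 0 < fine s.
  by apply: lt_le_trans (bound r1 (lexx _)); rewrite divr_gt0 ?hpos ?mulr_gt0.
exists (fine s); first by rewrite s0 -lte_fin fineK.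
exists r1 => // r r1r; rewrite -ler_pdivrMr; first exact: bound.
by rewrite hpos// (lt_le_trans r10).
Qed.

Lemma nneseries_ub (u : nat -> \bar R) (x : \bar R) : (forall k, 0 <= u k)%E ->
  (forall N, \sum_(0 <= k < N) u k <= x)%E -> (\sum_(k <oo) u k <= x)%E.
Proof.
move=> u0 ux; apply: lime_le; first by apply: is_cvg_nneseries.
exact: nearW.
Qed.

Lemma geometric_iter_le h (b rho r0 : R) : 0 < rho -> 1 < b ->  0 < r0 ->
  (forall r, r0 <= r -> h (b * r) <= rho * h r) ->
  forall r n, r0 <= r -> h (r * b ^+ n) <= rho ^+ n * h r.
Proof.
move=> rho0 b1 r00 H r n r0r; elim: n => [|n IH].
  by rewrite !expr0 mulr1 mul1r.
rewrite exprS mulrCA (le_trans (H _ _))//.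
  rewrite (le_trans r0r)// ler_peMr ?exprn_ege1// ltW//.
  exact: lt_le_trans r0r.
by rewrite exprS -mulrA ler_pM2l.
Qed.

Lemma geometric_iter_ge h (b kappa r0 : R) : 0 < kappa -> 1 < b -> 0 < r0 ->
  (forall r, r0 <= r -> kappa * h r <= h (b * r)) ->
  forall r n, r0 <= r -> kappa ^+ n * h r <= h (r * b ^+ n).
Proof.
move=> k0 b1 r00 H r n r0r; elim: n => [|n IH].
  by rewrite !expr0 mulr1 mul1r.
rewrite [b ^+ n.+1]exprS mulrCA (le_trans _ (H _ _))//.
  by rewrite exprS -mulrA ler_pM2l.
rewrite (le_trans r0r)// ler_peMr ?exprn_ege1// ltW//.
exact: lt_le_trans r0r.
Qed.

Lemma band_exists (b r v : R) : 1 < b -> 0 < v -> v <= r ->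
  exists l, r * b ^- l.+1 < v <= r * b ^- l.
Proof.
move=> b1 v0 vr; have b0 : 0 < b by apply: lt_trans b1.
have r0 : 0 < r by apply: lt_le_trans vr.
have ex : exists l, r * b ^- l.+1 < v.
  pose N := Num.truncn (r / v / (b - 1)).
  have b'0 : 0 < b - 1 by rewrite subr_gt0.
  (* Bernoulli's inequality makes the powers of b exceed r / v *)
  have bern n : 1 + n%:R * (b - 1) <= b ^+ n.
    elim: n => [|n IH]; first by rewrite mul0r addr0 expr0.
    rewrite exprS; apply: le_trans (_ : b * (1 + n%:R * (b - 1)) <= _); last by rewrite ler_pM2l.
    rewrite -subr_ge0 -natr1 (_ : _ - _ = n%:R * (b - 1) ^+ 2); last by ring.
    by rewrite mulr_ge0// sqr_ge0.
  exists N; rewrite ltr_pdivrMr ?exprn_gt0// mulrC -ltr_pdivrMr//.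
  apply: lt_le_trans (bern N.+1).
  by rewrite ltr_wpDl// -ltr_pdivrMr// truncnS_gt.
case: (ex_minnP ex) => l lv lmin; exists l; rewrite lv/=.
case: l lv lmin => [|l] lv lmin; first by rewrite expr0 invr1 mulr1.
by rewrite leNgt; apply/negP => /lmin; rewrite ltnn.
Qed.

Lemma geometric_nneseries_le (s : R) : 0 < s < 1 ->
  (\sum_(k <oo) (s ^+ k)%:E <= ((1 - s)^-1)%:E)%E.
Proof.
move=> /andP[s0 s1]; apply: nneseries_ub => [k|N].
  by rewrite lee_fin exprn_ge0// ltW.
rewrite sumEFin lee_fin.
suff -> : \sum_(0 <= k < N) s ^+ k = (1 - s)^-1 - s ^+ N / (1 - s).
  by rewrite gerBl divr_ge0 ?exprn_ge0 ?subr_ge0// ltW.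
elim: N => [|N IH]; first by rewrite big_nil expr0 mul1r subrr.
by rewrite big_nat_recr//= IH exprS; field; lra.
Qed.

Lemma arithmetico_geometric_nneseries_le (b : R) (q : nat) : 1 < b ->
  (\sum_(k <oo) (b ^- k * (q + k)%:R)%:E
    <= (b / (b - 1) * (q%:R + (b - 1)^-1))%:E)%E.
Proof.
move=> b1; have b0 : 0 < b by apply: lt_trans b1.
have b'0 : 0 < b - 1 by rewrite subr_gt0.
apply: nneseries_ub => [k|N].
  by rewrite lee_fin mulr_ge0// invr_ge0 exprn_ge0// ltW.
rewrite sumEFin lee_fin.
suff -> : \sum_(0 <= k < N) b ^- k * (q + k)%:R =
    b / (b - 1) * (q%:R + (b - 1)^-1) -
    b ^- N * (b / (b - 1) * ((q + N)%:R + (b - 1)^-1)).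
  rewrite gerBl mulr_ge0 ?invr_ge0 ?exprn_ge0 ?ltW//.
  by rewrite mulr_gt0// ?divr_gt0// ltr_wpDl// invr_gt0.
elim: N => [|N IH]; first by rewrite big_nil expr0 invr1 mul1r addn0 subrr.
rewrite big_nat_recr//= IH addnS -[(q + N).+1%:R]natr1 exprS invfM.
move: (b ^- N) => z; field; rewrite !gt_eqF//.
Qed.

(** Up to the factor M, this bounds the mean total, in units of r, of the rounded
    values below r when every value is replaced by the upper end of its band. *)
Definition geometric_tail_sum h (b r : R) : \bar R :=
  (\sum_(l <oo) (b ^- l * h (r * b ^- l.+1))%:E)%E.

Section geometric_tail_sum.
Variables (h : R -> R) (b : R).
Hypothesis b1 : 1 < b.
Hypothesis h0 : forall r, 0 < r -> 0 <= h r.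
Hypothesis hni : forall r s, 0 < r -> r <= s -> h s <= h r.

Let b0 : 0 < b. Proof. exact: lt_trans b1. Qed.

Let term_ge0 r l : 0 < r -> (0 <= (b ^- l * h (r * b ^- l.+1))%:E)%E.
Proof.
move=> r0; rewrite lee_fin mulr_ge0 ?invr_ge0 ?exprn_ge0 ?(ltW b0)//.
by rewrite h0// mulr_gt0// invr_gt0 exprn_gt0.
Qed.

Lemma geometric_tail_sum_le r s : 0 < r -> r <= s ->
  (geometric_tail_sum h b s <= geometric_tail_sum h b r)%E.
Proof.
move=> r0 rs; apply: lee_nneseries => [l _ _|l _].
  by apply: term_ge0; exact: lt_le_trans rs.
rewrite lee_fin ler_wpM2l ?invr_ge0 ?exprn_ge0 ?(ltW b0)//.
apply: hni; first by rewrite mulr_gt0// invr_gt0 exprn_gt0.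
by rewrite ler_wpM2r// invr_ge0 exprn_ge0// ltW.
Qed.

Lemma geometric_tail_sum_rec r : 0 < r ->
  geometric_tail_sum h b (r * b) =
  ((h r)%:E + (b^-1)%:E * geometric_tail_sum h b r)%E.
Proof.
move=> r0; rewrite /geometric_tail_sum nneseries_recl//; last first.
  by move=> l _; apply: term_ge0; rewrite mulr_gt0.
congr (_ + _)%E.
  by rewrite expr0 invr1 mul1r expr1 mulfK// gt_eqF.
rewrite -nneseriesZl; last by move=> l _; exact: term_ge0.
rewrite -(nneseries_addn 1); last by move=> l; apply: term_ge0; rewrite mulr_gt0.
apply: eq_eseriesr => l _; rewrite addn1 -EFinM; congr EFin.
rewrite mulrA -invfM -exprS; congr (_ * h _).
by rewrite [in LHS]exprS invfM mulrA mulfK// gt_eqF.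
Qed.

(** The recursion adds a term of order rho^n and contracts by 1/b, so any sigma
    above both ratios is a rate of decay. *)
Lemma geometric_tail_sum_decay (rho sigma r0 : R) :
  0 < r0 -> 0 < rho < sigma -> b^-1 < sigma ->
  (forall r, r0 <= r -> h (b * r) <= rho * h r) ->
  (geometric_tail_sum h b r0 < +oo)%E ->
  exists2 A, 0 < A & forall n,
    (geometric_tail_sum h b (r0 * b ^+ n) <= (A * sigma ^+ n)%:E)%E.
Proof.
move=> r00 /andP[rho0 rs] bs hrho Wfin.
have s0 : 0 < sigma by apply: lt_trans rs.
have d0 : 0 < sigma - b^-1 by rewrite subr_gt0.
have W0 : (0 <= geometric_tail_sum h b r0)%E.
  by apply: nneseries_ge0 => l _ _; exact: term_ge0.
(* the last two summands make the induction step and the positivity of A work *)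
pose A := fine (geometric_tail_sum h b r0) + h r0 / (sigma - b^-1) + 1.
have A1 : fine (geometric_tail_sum h b r0) <= A.
  by rewrite /A -addrA lerDl addr_ge0// divr_ge0 ?h0// ltW.
have A2 : h r0 <= A * (sigma - b^-1).
  by rewrite -ler_pdivrMr// /A addrAC lerDr addr_ge0// fine_ge0.
have A0 : 0 < A by rewrite /A ltr_wpDl// addr_ge0 ?fine_ge0// divr_ge0 ?h0// ltW.
exists A => //; elim=> [|n IH].
  by rewrite !expr0 !mulr1 -lee_fin fineK ?ge0_fin_numE// in A1 *.
have rn0 : 0 < r0 * b ^+ n by rewrite mulr_gt0// exprn_gt0.
rewrite exprSr mulrA geometric_tail_sum_rec//.
apply: (@le_trans _ _ ((h (r0 * b ^+ n))%:E + (b^-1)%:E * (A * sigma ^+ n)%:E)%E).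
  by rewrite leeD2l// lee_wpmul2l// lee_fin invr_ge0 ltW.
rewrite -EFinM -EFinD lee_fin.
have hn : h (r0 * b ^+ n) <= sigma ^+ n * h r0.
  apply: (le_trans (geometric_iter_le rho0 b1 r00 hrho n (lexx r0))).
  by rewrite ler_wpM2r ?h0// lerXn2r ?nnegrE ?(ltW rho0) ?(ltW s0) ?(ltW rs).
have : sigma ^+ n * h r0 <= sigma ^+ n * (A * (sigma - b^-1)).
  by rewrite ler_pM2l// exprn_gt0.
by move: hn; rewrite [sigma ^+ n.+1]exprSr; nra.
Qed.

End geometric_tail_sum.
End regular_tails.

Section small_jumps.
Context {R : realType}.
Variable lambda : {measure set (measurableTypeR R) -> \bar R}.
Hypothesis levy : levy_measure lambda.
Hypothesis small : (\int[lambda]_(z in `]0%R, 1%R]) z%:E < +oo)%E.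
Variable b : R.
Hypothesis b1 : 1 < b.

Let L x : R := fine (tail lambda x).
Let F x : \bar R := (\int[lambda]_(z in `]x, 1%R]) z%:E)%E.

Let F_fin x : 0 < x -> F x \is a fin_num.
Proof.
move=> x0; rewrite ge0_fin_numE; last first.
  by apply: integral_ge0 => z /=; rewrite in_itv/= lee_fin => /andP[/ltW/(lt_le_trans x0)/ltW].
apply: le_lt_trans small; apply: ge0_subset_integral => //.
- by move=> z /=; rewrite in_itv/= lee_fin => /andP[/ltW].
- by apply: subset_itvr; rewrite bnd_simp ltW.
Qed.

Let band_mean x y : 0 < x -> x <= y -> y <= 1 ->
  x * (L x - L y) <= fine (F x) - fine (F y).
Proof.
move=> x0 xy y1; have y0 : 0 < y by apply: lt_le_trans xy.
have Ty := tail_fin_num levy y0; have Tx := tail_fin_num levy x0.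
have Fx := F_fin x0; have Fy := F_fin y0.
have band_fin : lambda `]x, y]%classic \is a fin_num.
  rewrite ge0_fin_numE//; apply: le_lt_trans (tail_fin levy x0).
  by apply: le_measure; rewrite ?inE//; apply: subset_itvl.
have -> : L x - L y = fine (lambda `]x, y]%classic).
  by rewrite /L (tail_band _ xy) fineD// addrK.
have FE : F x = ((\int[lambda]_(z in `]x, y]) z%:E) + F y)%E.
  rewrite /F -ge0_integral_setU//=.
  - congr (integral _ _ _); rewrite -itv_bndbnd_setU// bnd_simp//.
  - by move=> z [] /=; rewrite !in_itv/= lee_fin => /andP[/ltW xz _];
     [rewrite (le_trans (ltW x0))|rewrite (le_trans (ltW y0))].
  - apply/disj_setPS => z [] /=; rewrite !in_itv/= => /andP[_ zy].
    by rewrite ltNge zy.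
rewrite lerBrDr -lee_fin EFinD EFinM !fineK// FE leeD2r//.
apply: cst_mul_measure_le_integral => //; first exact: ltW.
- by move=> z /=; rewrite in_itv/= lee_fin => /andP[/ltW xz _]; rewrite (le_trans (ltW x0)).
- by move=> z /=; rewrite in_itv/= lee_fin => /andP[/ltW].
Qed.

(** Summation by parts turns the weighted sum of tails into a weighted sum of
    the masses of the bands, which the mean of the small jumps dominates. *)
Lemma small_jumps_geometric_tail_sum : (geometric_tail_sum L b 1 < +oo)%E.
Proof.
have b0 : 0 < b by apply: lt_trans b1.
have b'0 : 0 < b - 1 by rewrite subr_gt0.
pose g l := b ^- l.
have g0 l : 0 < g l by rewrite invr_gt0 exprn_gt0.
have gS l : g l.+1 <= g l.
  by rewrite /g exprS invfM ler_piMl ?invf_le1 ?(ltW b1)// ltW// g0.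
have g1 l : g l <= 1 by rewrite invf_le1 ?exprn_gt0// exprn_ege1// ltW.
have L0 l : 0 <= L l by rewrite fine_ge0// measure_ge0.
pose D := b / (b - 1).
have D0 : 0 < D by rewrite divr_gt0.
apply: (@le_lt_trans _ _ (D * (L (g 1%N) + b * fine (F 0)))%:E); last exact: ltry.
apply: nneseries_ub => [l|N].
  by rewrite lee_fin mulr_ge0 ?L0// ltW// g0.
rewrite sumEFin lee_fin.
under eq_bigr do rewrite mul1r.
have F0 l : fine (F (g l)) <= fine (F 0).
  have Fsub : (F (g l) <= F 0)%E.
    apply: ge0_subset_integral => //.
    - by move=> z /=; rewrite in_itv/= lee_fin => /andP[/ltW].
    - by apply: subset_itvr; rewrite bnd_simp ltW.
  apply: fine_le => //; first exact: F_fin.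
  by rewrite ge0_fin_numE// integral_ge0// => z /=; rewrite in_itv/= lee_fin => /andP[/ltW].
(* D (g N) is the sum of the weights from N on: the summation by parts is
   exact once the boundary term D (g N) L (g N.+1) is kept. *)
suff : \sum_(0 <= l < N) g l * L (g l.+1) + D * g N * L (g N.+1)
     <= D * (L (g 1%N) + b * (fine (F (g N.+1)) - fine (F (g 1%N)))).
  have := F0 N.+1; have : 0 <= fine (F (g 1%N)).
    by rewrite fine_ge0// integral_ge0// => z /=;
      rewrite in_itv/= lee_fin => /andP[/ltW/(le_trans (ltW (g0 1%N)))].
  have : 0 <= D * g N * L (g N.+1) by apply: mulr_ge0; [apply: mulr_ge0; apply: ltW|exact: L0].
  move: (\sum_(_ <= _ < _) _) => S SN F1 FN H.
  apply: le_trans (_ : S + D * g N * L (g N.+1) <= _); first by rewrite lerDl.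
  apply: (le_trans H); rewrite ler_pM2l// lerD2l ler_pM2l//; lra.
elim: N => [|N IH].
  by rewrite big_nil add0r /g expr0 invr1 mulr1 subrr mulr0 addr0.
rewrite big_nat_recr//=.
have gD : D * g N.+1 + g N = D * g N.
  by rewrite /D /g exprS invfM; move: (b ^- N) => z; field; rewrite !gt_eqF.
have := band_mean (g0 N.+2) (gS N.+1) (g1 N.+1).
have -> : g N.+2 = g N.+1 / b by rewrite /g [in LHS]exprS invfM mulrC.
move: IH gD; move: (\sum_(_ <= _ < _) _) (L (g N.+1)) (L (g N.+1 / b)) => S l1 l2.
move: (fine (F (g N.+1))) => f1.
move: (fine (F (g N.+1 / b))) => f2 IH gD band.
have : g N.+1 * (l2 - l1) <= b * (f2 - f1).
  by move: band; rewrite mulrAC ler_pdivrMr// mulrC [_ * b]mulrC.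
move=> /(ler_wpM2l (ltW D0)) band'.
have : S + g N * l1 + D * g N.+1 * l2 = S + D * g N * l1 + D * (g N.+1 * (l2 - l1)).
  by rewrite -gD; ring.
by move: IH band' => + + ->; nra.
Qed.

End small_jumps.

(** * Intensity of the rounded values *)

Section slabs.
Context {R : realType}.
Variables (b t : R).
Hypothesis b1 : 1 < b.

(** For u in [t, t + 1) the discount factor of a point of slab j is at most
    b^-j; the positive part puts the points with s in (t, t + 1], for which
    only the bound 1 is available, into slab 0. *)
Definition slab (j : nat) : set (measurableTypeR R * measurableTypeR R) :=
  [set p | [/\ 0 < p.1, p.2 <= t + 1 &
    j%:R * ln b <= p.1 * Num.max (t - p.2) 0 < j.+1%:R * ln b]].

Lemma measurable_slab j : measurable (slab j).
Proof.
pose age (p : measurableTypeR R * measurableTypeR R) := p.1 * Num.max (t - p.2) 0.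
have m1 : measurable_fun setT (fst : measurableTypeR R * measurableTypeR R -> R).
    exact: measurable_fst.
have m2 : measurable_fun setT (snd : measurableTypeR R * measurableTypeR R -> R).
    exact: measurable_snd.
have mage : measurable_fun setT age.
  apply: measurable_funM => //; apply: measurable_maxr => //.
  exact: measurable_funB.
rewrite (_ : slab j = (fst @^-1` `]0, +oo[) `&` ((snd @^-1` `]-oo, t + 1]) `&`
   (age @^-1` `[j%:R * ln b, j.+1%:R * ln b[))).
  apply: measurableI; first by rewrite -[X in measurable X]setTI; exact: m1.
  apply: measurableI; first by rewrite -[X in measurable X]setTI; exact: m2.
  by rewrite -[X in measurable X]setTI; exact: mage.
apply/seteqP; split => p; rewrite /slab/= !in_itv/= andbT.
  by case.
by case=> ? [].
Qed.

Lemma slab_cover x s : 0 < x -> s <= t + 1 -> exists j, slab j (x, s).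
Proof.
move=> x0 st; exists (Num.truncn (x * Num.max (t - s) 0 / ln b)).
have lnb : 0 < ln b by rewrite ln_gt0.
split => //=.
rewrite -ler_pdivlMr// -ltr_pdivrMr// truncnS_gt andbT truncn_le//.
by rewrite divr_ge0 ?(ltW lnb)// mulr_ge0 ?(ltW x0)// le_max lexx orbT.
Qed.

Lemma slab_discount j x s u : slab j (x, s) -> t <= u -> s <= u ->
  expR (- x * (u - s)) <= b ^- j.
Proof.
move=> [/= x0 _ /andP[jx _]] tu su.
have -> : b ^- j = expR (- (j%:R * ln b)).
  by rewrite expRN mulrC expRM_natr lnK// posrE (lt_trans _ b1).
rewrite ler_expR mulNr lerN2; apply: (le_trans jx).
by rewrite ler_pM2l// ge_max lerD2r tu subr_ge0.
Qed.

Variable pi : {measure set (measurableTypeR R) -> \bar R}.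

(** At a given x the slab is contained in an interval of length ln b / x and,
    for the points with s > t, in [t, t + 1]. *)
Lemma slab_measure j :
  ((pi \x lebesgue_measure)%E (slab j)
    <= moment pi 0 + (ln b)%:E * moment pi (-1))%E.
Proof.
have lnb : 0 < ln b by rewrite ln_gt0.
rewrite /moment -ge0_integralZl//=; last 3 first.
- apply/measurable_EFinP; apply: measurable_funTS; exact: measurable_powR.
- by move=> x _; rewrite lee_fin powR_ge0.
- by rewrite lee_fin ltW.
rewrite -ge0_integralD//=; last 4 first.
- by move=> x _; rewrite lee_fin powR_ge0.
- apply/measurable_EFinP; apply: measurable_funTS; exact: measurable_powR.
- by move=> x _; rewrite mule_ge0// lee_fin ?powR_ge0 ?ltW.
- apply: measurable_funTS; apply: measurable_funeM.
  by apply/measurable_EFinP; exact: measurable_powR.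
have -> : ((pi \x lebesgue_measure)%E (slab j) =
    \int[pi]_(x in `]0%R, +oo[) lebesgue_measure (xsection (slab j) x))%E.
  rewrite [RHS]integral_mkcond; apply: eq_integral => x _ /=.
  rewrite patchE; case: ifPn => // /negP x0.
  rewrite (_ : xsection _ _ = set0) ?measure0//.
  apply/seteqP; split => // s /xsectionP[/= xpos _ _]; apply: x0.
  by rewrite inE/= in_itv/= xpos.
apply: ge0_le_integral => //.
- apply: measurable_funTS.
  have := @measurable_fun_xsection _ _ _ _ R (@lebesgue_measure R) _ (measurable_slab j).
  exact.
- apply/measurable_EFinP; apply: measurable_funTS; apply: measurable_funD.
    exact: measurable_powR.
  by apply: measurable_funM => //; exact: measurable_powR.
move=> x /=; rewrite in_itv/= andbT => x0.
rewrite powRr0 powR_inv1 ?(ltW x0)//.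
apply: (@le_trans _ _ (lebesgue_measure (`[t, t + 1]%classic `|`
   `[t - j.+1%:R * ln b / x, t - j%:R * ln b / x]%classic))).
  apply: le_measure; rewrite ?inE.
  - by apply: measurable_xsection; exact: measurable_slab.
  - exact: measurableU.
  move=> s /xsectionP[/= _ st /andP[jx xj]].
  have [ts|st'] := leP t s; first by left; rewrite /= in_itv/= ts.
  right; rewrite /= in_itv/=; move: jx xj.
  rewrite max_l ?subr_ge0 ?(ltW st')// => jx xj.
  rewrite lerBlDr addrC -lerBlDr ler_pdivlMr// ltW; last by rewrite mulrC.
  by rewrite lerBrDr addrC -lerBrDr ler_pdivrMr// [(t - s) * x]mulrC.
apply: (le_trans (measureU2 _ _ _)) => //.
rewrite /= !lebesgue_measure_itv/= !lte_fin ltrDl ltr01.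
apply: leeD; first by rewrite -EFinB lee_fin; lra.
case: ifP => _; last by rewrite mule_ge0// lee_fin ?invr_ge0 ltW.
rewrite -EFinB -EFinM lee_fin -natr1.
by rewrite [leLHS](_ : _ = ln b / x)//; ring.
Qed.

End slabs.

Section intensity_of_slab_regions.
Context {R : realType}.
Variables (pi lambda : {measure set (measurableTypeR R) -> \bar R}).
Variable nu : {measure set (measurableTypeR R * measurableTypeR R * measurableTypeR R) -> \bar R}.
Hypothesis nuX : forall A B, measurable A -> measurable B ->
  nu (A `*` B) = ((pi \x lebesgue_measure)%E A * lambda B)%E.
Hypothesis levy : levy_measure lambda.
Variables (b t M : R).
Hypothesis b1 : 1 < b.
Hypothesis M0 : 0 <= M.
Hypothesis slabM : forall j, ((pi \x lebesgue_measure)%E (slab b t j) <= M%:E)%E.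

Let b0 : 0 < b. Proof. exact: lt_trans b1. Qed.
Let L x : R := fine (tail lambda x).

Definition slab_region (C : nat -> set (measurableTypeR R)) :=
  \bigcup_j (slab b t j `*` C j).

Lemma measurable_slab_region C : (forall j, measurable (C j)) ->
  measurable (slab_region C).
Proof.
by move=> mC; apply: bigcupT_measurable => j; apply: measurableX => //; exact: measurable_slab.
Qed.

Lemma slab_region_le C : (forall j, measurable (C j)) ->
  (nu (slab_region C) <= M%:E * \sum_(j <oo) lambda (C j))%E.
Proof.
move=> mC.
have mSC j : measurable (slab b t j `*` C j).
  by apply: measurableX => //; exact: measurable_slab.
apply: (le_trans (measure_sigma_subadditive nu mSC (measurable_slab_region mC) (@subset_refl _ _))).
rewrite -nneseriesZl//; apply: lee_nneseries => // j _.
rewrite nuX//; last exact: measurable_slab.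
by rewrite lee_wpmul2r.
Qed.

(** The points whose rounded value b^-j z exceeds r. *)
Definition top_region r := slab_region (fun j => `]r * b ^+ j, +oo[%classic).

(** The points whose rounded value lies in (x, b x]. *)
Definition band_region x := slab_region (fun j => `]x * b ^+ j, x * b ^+ j.+1]%classic).

Lemma measurable_top_region r : measurable (top_region r).
Proof. exact: measurable_slab_region. Qed.

Lemma measurable_band_region x : measurable (band_region x).
Proof. exact: measurable_slab_region. Qed.

Lemma top_region_le (rho r0 r : R) : 0 < rho < 1 -> 0 < r0 ->
  (forall r, r0 <= r -> L (b * r) <= rho * L r) -> r0 <= r ->
  (nu (top_region r) <= (M * (1 - rho)^-1 * L r)%:E)%E.
Proof.
move=> /[dup] rho01 /andP[rho0 rho1] r00 Lrho r0r.
have rpos : 0 < r by apply: lt_le_trans r0r.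
apply: (le_trans (slab_region_le _)) => //.
rewrite -mulrA EFinM lee_wpmul2l// EFinM [leRHS]muleC.
apply: (@le_trans _ _ (\sum_(j <oo) ((L r)%:E * (rho ^+ j)%:E))%E).
  apply: lee_nneseries => // j _.
  have rj : 0 < r * b ^+ j by rewrite mulr_gt0// exprn_gt0.
  rewrite -[leLHS]fineK; last exact: tail_fin_num.
  rewrite -EFinM lee_fin [leRHS]mulrC.
  exact: (geometric_iter_le rho0 b1 r00 Lrho).
rewrite nneseriesZl; last by move=> j _; rewrite lee_fin exprn_ge0// ltW.
by rewrite lee_wpmul2l// ?lee_fin ?fine_ge0//; exact: geometric_nneseries_le.
Qed.

(** The intervals of the different slabs are disjoint and fill (x, oo), whence
    a single tail of lambda instead of a sum of tails. *)
Lemma band_region_le x : 0 < x -> (nu (band_region x) <= (M * L x)%:E)%E.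
Proof.
move=> x0; apply: (le_trans (slab_region_le _)) => //.
rewrite EFinM lee_wpmul2l// fineK ?tail_fin_num//.
apply: nneseries_ub => // N.
suff -> : tail lambda x = (\sum_(0 <= k < N) lambda `](x * b ^+ k)%R, (x * b ^+ k.+1)%R]%classic
     + tail lambda (x * b ^+ N)%R)%E by rewrite leeDl.
elim: N => [|N IH]; first by rewrite big_nil add0e expr0 mulr1.
rewrite big_nat_recr//= -addeA -tail_band//.
by rewrite ler_pM2l// exprS ler_peMl ?ltW// exprn_gt0.
Qed.

End intensity_of_slab_regions.

(** * Tail of the supremum over a unit interval *)

Section pathwise_bound.
Context {R : realType} {d : measure_display} {Omega : measurableType d}.
Variables (xi tau zeta : nat -> Omega -> R).
Hypothesis points_pos : forall k w, 0 < xi k w /\ 0 < zeta k w.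
Variables (b t : R).
Hypothesis b1 : 1 < b.

Let b0 : 0 < b. Proof. exact: lt_trans b1. Qed.

Let pt k w : measurableTypeR R * measurableTypeR R * measurableTypeR R :=
  (xi k w, tau k w, zeta k w).
Let mu := point_measure (R := R) pt.

Let muE w A : mu w A = (\sum_(k <oo) \d_(pt k w) A)%E.
Proof. by []. Qed.

(** Without points in the top region, every term of X(u) is at most the upper
    end r b^-l of the band of its rounded value; exchanging the two sums counts
    the points of each band. *)
Lemma supOU_le_bands (r u : R) (w : Omega) : 0 < r -> t <= u < t + 1 ->
  mu w (top_region b t r) = 0%E ->
  (supOU xi tau zeta u w <=
   \sum_(l <oo) (r * b ^- l)%:E * mu w (band_region b t (r * b ^- l.+1)))%E.
Proof.
move=> r0 /andP[tu ut] notop.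
rewrite /supOU.
apply: (@le_trans _ _ (\sum_(k <oo | (tau k w <= u)%R) \sum_(l <oo)
   (r * b ^- l)%:E * \d_(pt k w) (band_region b t (r * b ^- l.+1)))%E); last first.
  apply: (@le_trans _ _ (\sum_(k <oo) \sum_(l <oo)
   (r * b ^- l)%:E * \d_(pt k w) (band_region b t (r * b ^- l.+1)))%E).
    apply: subset_lee_nneseries => // k _; apply: nneseries_ge0 => l _ _.
    by rewrite mule_ge0// lee_fin mulr_ge0 ?ltW// invr_gt0 exprn_gt0.
  rewrite nneseries_interchange; last first.
    by move=> k l; rewrite mule_ge0// lee_fin mulr_ge0 ?ltW// invr_gt0 exprn_gt0.
  apply: lee_nneseries => [l _ _|l _].
    apply: nneseries_ge0 => k _ _.
    by rewrite mule_ge0// lee_fin mulr_ge0 ?ltW// invr_gt0 exprn_gt0.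
  by rewrite nneseriesZl// muE.
apply: lee_nneseries => [k _ _|k taku].
  by rewrite lee_fin mulr_ge0 ?expR_ge0// ltW//; case: (points_pos k w).
have [x0 z0] := points_pos k w.
have [|j sj] := slab_cover b1 (t := t) (s := tau k w) x0.
  by rewrite (le_trans taku)// ltW.
have bj0 : 0 < b ^+ j by rewrite exprn_gt0.
have zr : zeta k w <= r * b ^+ j.
  rewrite leNgt; apply/negP => zr.
  have : (\d_(pt k w) (top_region b t r) <= mu w (top_region b t r))%E.
    rewrite muE (nneseriesD1 (n := k))// leeDl//; apply: nneseries_ge0 => //.
  rewrite notop diracE mem_set ?lee_fin ?ler10//.
  by exists j => //; split => //=; rewrite in_itv/= zr.
have [l /andP[lv vl]] := band_exists b1 (r := r) (v := zeta k w / b ^+ j)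
  (divr_gt0 z0 bj0) (ltac:(by rewrite ler_pdivrMr)).
have inB : pt k w \in band_region b t (r * b ^- l.+1).
  apply/mem_set; exists j => //; split => //=; rewrite in_itv/=.
  rewrite -ltr_pdivlMr// lv/= -mulrA (_ : b ^- l.+1 * b ^+ j.+1 = b ^- l * b ^+ j).
    by rewrite mulrA -(ler_pdivrMr _ _ bj0).
  by rewrite !exprS invfM mulrACA mulVf ?mul1r// gt_eqF.
apply: (@le_trans _ _ ((r * b ^- l)%:E * \d_(pt k w) (band_region b t (r * b ^- l.+1)))%E).
  rewrite diracE inB mule1 lee_fin; apply: le_trans vl.
  rewrite mulrC ler_pM2l//; apply: (slab_discount b1 sj) => //.
rewrite (nneseriesD1 (n := l))//; last first.
  by move=> i _; rewrite mule_ge0// lee_fin mulr_ge0 ?ltW// invr_gt0 exprn_gt0.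
rewrite leeDl//; apply: nneseries_ge0 => i _ _.
by rewrite mule_ge0// lee_fin mulr_ge0 ?ltW// invr_gt0 exprn_gt0.
Qed.

End pathwise_bound.

Section supremum_over_unit_interval.
Context {R : realType} {d : measure_display} {Omega : measurableType d}.
Variable P : probability Omega R.
Variables (pi lambda : {measure set (measurableTypeR R) -> \bar R}).
Variables (xi tau zeta : nat -> {RV P >-> R}).
Hypothesis levy : levy_measure lambda.
Hypothesis points : supOU_points pi lambda xi tau zeta.

Let L x : R := fine (tail lambda x).
Let mu := point_measure (R := R) (fun k w => (xi k w, tau k w, zeta k w)
         : measurableTypeR R * measurableTypeR R * measurableTypeR R).

Lemma poisson_random_measure_tails A (m : R) : measurable A ->
  ((pi \x lebesgue_measure \x lambda)%E A <= m%:E)%E ->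
  (0 <= (pi \x lebesgue_measure \x lambda)%E A)%E ->
  (P [set w | mu w A <> 0%E] <= m%:E)%E /\
  forall th y, 0 <= th ->
   (P [set w | (y%:E <= mu w A)%E] <= (expR (m * expR th - th * y))%:E)%E.
Proof.
move=> mA nuAm nuA0; have [_ [mmu pmf _ _]] := points.
have nuA : ((pi \x lebesgue_measure \x lambda)%E A < +oo)%E.
  by apply: le_lt_trans nuAm _; rewrite ltry.
have fm : fine ((pi \x lebesgue_measure \x lambda)%E A) <= m.
  by rewrite -lee_fin fineK// ge0_fin_numE.
have f0 : 0 <= fine ((pi \x lebesgue_measure \x lambda)%E A) by rewrite fine_ge0.
split=> [|th y th0].
  by apply: (le_trans (poisson_gt0 (mmu A mA) (pmf A mA nuA))); rewrite lee_fin.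
apply: (le_trans (poisson_chernoff (mmu A mA) f0 (pmf A mA nuA) y th0)).
by rewrite lee_fin ler_expR lerD2r ler_wpM2r// expR_ge0.
Qed.

Hypothesis m0 : (moment pi 0 < +oo)%E.
Hypothesis m1 : (moment pi (-1) < +oo)%E.
Hypothesis small : (\int[lambda]_(z in `]0%R, 1%R]) z%:E < +oo)%E.
Hypothesis domvar : dominatedly_varying L.
Variable c : R.
Hypothesis c1 : 1 < c.
Hypothesis ratio :
  (limf_esup (fun r => (L (c * r) / L r)%:E) +oo%R < 1)%E.

(** Outside an event of probability at most C1 L(r), with r = r0 c^n, there is no
    point in the top region and each band contains fewer points than its
    threshold; the thresholds bound the sum over the bands by C0 r. *)
Lemma supOU_unit_interval_tail : exists C0 C1 r0 : R,
  [/\ 0 < C0, 0 <= C1, 0 < r0 & forall (t : R) n, (0 < n)%N ->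
  exists2 E : set Omega, measurable E /\ (P E <= (C1 * L (r0 * c ^+ n))%:E)%E &
    forall w u, ~ E w -> t <= u < t + 1 ->
      (supOU xi tau zeta u w <= (C0 * (r0 * c ^+ n))%:E)%E].
Proof.
have c0 : 0 < c by apply: lt_trans c1.
have [Lni Lpos _] := domvar.
have L0 r : 0 < r -> 0 <= L r by move=> /Lpos/ltW.
have [rho rho01 [rA rA0 HA]] := tail_ratio_lt1 c0 Lpos ratio.
have [kappa kappa01 [rB rB0 HB]] := dominatedly_varying_scale c0 domvar.
have /andP[rho0 rho1] := rho01; have /andP[kappa0 kappa1] := kappa01.
pose r0 := Num.max 1 (Num.max rA rB).
have r0_1 : 1 <= r0 by rewrite le_max lexx.
have r00 : 0 < r0 by apply: lt_le_trans r0_1.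
have rhoP r : r0 <= r -> L (c * r) <= rho * L r.
  by move=> r0r; apply: HA; apply: le_trans r0r; rewrite !le_max lexx orbT.
have kappaP r : r0 <= r -> kappa * L r <= L (c * r).
  by move=> r0r; apply: HB; apply: le_trans r0r; rewrite !le_max lexx !orbT.
have cV1 : c^-1 < 1 by rewrite invf_lt1.
pose sigma := (1 + Num.max rho c^-1) / 2.
have [s0 s1 rs cs] : [/\ 0 < sigma, sigma < 1, rho < sigma & c^-1 < sigma].
  by rewrite /sigma; move: (c^-1) cV1 => v v1; case: (leP rho v) => ?; split; lra.
have [A A0 HW] : exists2 A, 0 < A & forall n,
    (geometric_tail_sum L c (r0 * c ^+ n) <= (A * sigma ^+ n)%:E)%E.
  apply: (geometric_tail_sum_decay c1 L0 r00 _ cs rhoP) => //.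
  - by rewrite rho0.
  - apply: le_lt_trans (small_jumps_geometric_tail_sum levy small c1).
    exact: (geometric_tail_sum_le c1 L0 Lni).
have [q Hq] : exists q, sigma ^+ q <= kappa.
  have lns : ln sigma < 0 by rewrite ln_lt0// s0.
  exists (Num.truncn (ln kappa / ln sigma)).+1.
  rewrite -ler_ln ?posrE ?exprn_gt0// lnXn// -mulr_natl -ler_ndivrMr//.
  by rewrite ltW// truncnS_gt.
pose M := fine (moment pi 0) + ln c * fine (moment pi (-1)).
have mom0 p : (0 <= moment pi p)%E by apply: integral_ge0 => x _; rewrite lee_fin powR_ge0.
have M0 : 0 <= M by rewrite addr_ge0 ?mulr_ge0 ?fine_ge0// ln_ge0// ltW.
have slabM t j : ((pi \x lebesgue_measure)%E (slab c t j) <= M%:E)%E.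
  apply: (le_trans (slab_measure t c1 pi j)).
  by rewrite /M EFinD EFinM !fineK// ge0_fin_numE.
have [nu [nuE nuX]] := product_measure_exists (pi \x lebesgue_measure)%E (levy_sigma_finite levy).
pose th1 := - ln sigma.
have th10 : 0 < th1 by rewrite oppr_gt0 ln_lt0// s0.
have eth n : expR (n%:R * th1) = sigma ^- n.
  by rewrite mulrN expRN mulrC expRM_natr lnK.
pose Cq := c / (c - 1) * (q%:R + (c - 1)^-1).
have c'0 : 0 < c - 1 by rewrite subr_gt0.
have Cq0 : 0 < Cq by rewrite mulr_gt0 ?divr_gt0// ltr_wpDl// invr_gt0.
(* C0 collects the tilted means and the sum of the c^-l (q + l); C1 collects the
   top region and the union over the bands. *)
pose C0 := M * A / th1 + Cq.
pose C1 := M * (1 - rho)^-1 + (L r0 * (1 - sigma))^-1.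
have C00 : 0 < C0 by rewrite ltr_wpDl// divr_ge0 ?mulr_ge0// ltW.
have C10 : 0 <= C1.
  apply: addr_ge0; first by rewrite mulr_ge0// invr_ge0 subr_ge0 ltW.
  by rewrite invr_ge0 mulr_ge0 ?L0// subr_ge0 ltW.
exists C0, C1, r0; split=> // t n n0.
pose r := r0 * c ^+ n.
have rpos : 0 < r by rewrite mulr_gt0// exprn_gt0.
have r0r : r0 <= r by rewrite ler_peMr ?exprn_ege1// ltW.
pose th := n%:R * th1.
have th0 : 0 <= th by rewrite mulr_ge0// ltW.
have th1th : th1 <= th by rewrite ler_peMl ?ler1n// ltW.
pose m l := M * L (r * c ^- l.+1).
have rl0 l : 0 < r * c ^- l.+1 by rewrite mulr_gt0// invr_gt0 exprn_gt0.
(* as th1 <= th, the first summand absorbs the term m l * expR th of the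
   Chernoff exponent *)
pose y l := m l * expR th / th1 + (q + l)%:R.
pose Etop := [set w | mu w (top_region c t r) <> 0%E].
pose Eband l := [set w | ((y l)%:E <= mu w (band_region c t (r * c ^- l.+1)))%E].
have [_ [mmu _ _ _]] := points.
have mtop : measurable (top_region c t r) by exact: measurable_top_region.
have mband l : measurable (band_region c t (r * c ^- l.+1)) by exact: measurable_band_region.
have mEtop : measurable Etop.
  rewrite -[X in measurable X]setTI.
  rewrite (_ : Etop = (mu ^~ (top_region c t r)) @^-1` (~` [set 0%E]))//.
  by apply: mmu => //; apply: measurableC.
have mEband l : measurable (Eband l).
  by apply: measurable_ge_level; exact: mmu.
have PEtop : (P Etop <= (M * (1 - rho)^-1 * L r)%:E)%E.
  apply: (proj1 (poisson_random_measure_tails mtop _ _)); rewrite -nuE//.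
  exact: (top_region_le nuX levy c1 M0 (slabM t) rho01 r00 rhoP).
have PEband l : (P (Eband l) <= (sigma ^+ (n * q))%:E * (sigma ^+ l)%:E)%E.
  apply: (@le_trans _ _ (expR (m l * expR th - th * y l))%:E).
    apply: (proj2 (poisson_random_measure_tails (mband l) _ _)) => //; rewrite -nuE//.
    exact: (band_region_le nuX levy c1 M0 (slabM t) (rl0 l)).
  rewrite -EFinM lee_fin.
  have -> : sigma ^+ (n * q) * sigma ^+ l = expR (- (n * q + l)%:R * th1).
    by rewrite mulrN mulNr opprK expRM_natl lnK// exprD.
  rewrite ler_expR /y mulrDr opprD addrA.
  have dom : m l * expR th <= th * (m l * expR th / th1).
    rewrite mulrCA ler_peMr ?mulr_ge0 ?expR_ge0 ?L0//.
    by rewrite ler_pdivlMr// mul1r.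
  have len : (n * q + l)%:R * th1 <= th * (q + l)%:R.
    rewrite /th mulrAC -natrM ler_pM2r// ler_nat mulnDr leq_add2l.
    by rewrite leq_pmull.
  lra.
exists (Etop `|` \bigcup_l Eband l).
  split; first by apply: measurableU => //; exact: bigcupT_measurable.
  apply: (le_trans (measureU2 _ _ _)) => //; first exact: bigcupT_measurable.
  rewrite mulrDl EFinD; apply: leeD => //.
  apply: (@le_trans _ _ (\sum_(l <oo) P (Eband l))%E).
    by apply: measure_sigma_subadditive => //; exact: bigcupT_measurable.
  apply: (@le_trans _ _ (\sum_(l <oo) ((sigma ^+ (n * q))%:E * (sigma ^+ l)%:E))%E).
    exact: lee_nneseries.
  rewrite nneseriesZl; last by move=> l _; rewrite lee_fin exprn_ge0// ltW.
  apply: (@le_trans _ _ ((sigma ^+ (n * q))%:E * ((1 - sigma)^-1)%:E)%E).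
    rewrite lee_wpmul2l ?lee_fin ?exprn_ge0 ?(ltW s0)//.
    by apply: geometric_nneseries_le; rewrite s0.
  rewrite -EFinM lee_fin invfM mulrAC ler_pM2r ?invr_gt0 ?subr_gt0//.
  rewrite [leRHS]mulrC ler_pdivlMr ?Lpos// mulnC exprM.
  apply: le_trans (geometric_iter_ge kappa0 c1 r00 kappaP n (lexx r0)).
  rewrite ler_pM2r ?Lpos// lerXn2r ?nnegrE ?exprn_ge0 ?(ltW s0) ?(ltW kappa0)//.
move=> w u /not_orP[/contrapT notop nobands] tu.
apply: (le_trans (supOU_le_bands _ c1 rpos tu notop)).
  by move=> k w'; case: points.
apply: (@le_trans _ _ (\sum_(l <oo)
   ((r * (M * expR th / th1))%:E * (c ^- l * L (r * c ^- l.+1))%:E +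
    r%:E * (c ^- l * (q + l)%:R)%:E))%E).
  apply: lee_nneseries => [l _ _|l _].
    by rewrite mule_ge0// lee_fin mulr_ge0 ?ltW// invr_gt0 exprn_gt0.
  have [] := leP (y l)%:E (mu w (band_region c t (r * c ^- l.+1))).
    by move=> yl; exfalso; apply: nobands; exists l.
  move=> /ltW muy; rewrite -!EFinM -EFinD.
  apply: (@le_trans _ _ ((r * c ^- l)%:E * (y l)%:E)%E).
    by rewrite lee_wpmul2l// lee_fin mulr_ge0 ?(ltW rpos)// invr_ge0 exprn_ge0// ltW.
  by rewrite -EFinM lee_fin /y /m le_eqVlt; apply/orP; left; apply/eqP; ring.
have W0 l : (0 <= (c ^- l * L (r * c ^- l.+1))%:E)%E.
  by rewrite lee_fin mulr_ge0 ?L0// invr_ge0 exprn_ge0// ltW.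
have Q0 l : (0 <= (c ^- l * (q + l)%:R)%:E :> \bar R)%E.
  by rewrite lee_fin mulr_ge0// invr_ge0 exprn_ge0// ltW.
have Me0 : 0 <= r * (M * expR th / th1).
  by rewrite mulr_ge0 ?(ltW rpos)// divr_ge0 ?(ltW th10)// mulr_ge0// expR_ge0.
rewrite nneseriesD; last 2 first.
- by move=> l _; rewrite mule_ge0.
- by move=> l _; rewrite mule_ge0// lee_fin ltW.
rewrite !nneseriesZl//.
rewrite -/(geometric_tail_sum L c r).
apply: (@le_trans _ _ ((r * (M * expR th / th1))%:E * (A * sigma ^+ n)%:E + r%:E * Cq%:E)%E).
  apply: leeD; first by rewrite lee_wpmul2l//; exact: HW.
  by rewrite lee_wpmul2l ?lee_fin ?(ltW rpos)//; exact: arithmetico_geometric_nneseries_le.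
rewrite -!EFinM -EFinD lee_fin /th eth /C0 -/r.
have sn : sigma ^- n * sigma ^+ n = 1 by rewrite mulVf// expf_neq0// gt_eqF.
have -> : r * (M * sigma ^- n / th1) * (A * sigma ^+ n) =
   r * (M * A / th1) * (sigma ^- n * sigma ^+ n) by ring.
by rewrite sn mulr1 -mulrDr mulrC.
Qed.

End supremum_over_unit_interval.

(** * Sums and integrals of nonincreasing functions *)

Section sum_integral_comparison.
Context {R : realType}.
Variable g : R -> R.
Hypothesis g0 : forall t, 1 <= t -> 0 <= g t.
Hypothesis gni : forall s t, 1 <= s -> s <= t -> g t <= g s.

Let mg : measurable_fun (`[1, +oo[%classic : set R) (fun t => (g t)%:E).
Proof.
apply/measurable_EFinP.
apply: (eq_measurable_fun (fun t : R => g (Num.max t 1))).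
  by move=> t /set_mem /=; rewrite in_itv/= andbT => t1; rewrite max_l.
apply: nonincreasing_measurable => // s t st; apply: gni.
  by rewrite le_max lexx orbT.
by rewrite ge_max !le_max st lexx/= orbT.
Qed.

Let cell (k : nat) : set R := `[k.+1%:R, k.+2%:R[%classic.

Let cells : (`[1, +oo[%classic : set R) = \bigcup_k cell k.
Proof.
apply/seteqP; split => t /=; rewrite in_itv/= ?andbT.
  move=> t1; exists (Num.truncn t).-1 => //; rewrite /cell/= in_itv/=.
  by rewrite prednK ?truncn_gt0// truncnS_gt truncn_le// (le_trans _ t1).
case=> k _; rewrite /cell/= in_itv/= => /andP[kt _]; apply: le_trans kt.
by rewrite ler1n.
Qed.

Lemma integral_eq_sum_cells :
  (\int[lebesgue_measure]_(t in `[1%R, +oo[) (g t)%:E =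
   \sum_(k <oo) \int[lebesgue_measure]_(t in cell k) (g t)%:E)%E.
Proof.
rewrite cells ge0_integral_bigcup//.
- by move=> k; exact: measurable_itv.
- by rewrite -cells.
- by rewrite -cells => t /=; rewrite in_itv/= andbT lee_fin; exact: g0.
- apply/trivIsetP => i j _ _ ij; apply/seteqP; split => // t [].
  rewrite /cell/= !in_itv/= => /andP[it ti] /andP[jt tj].
  move: ij; rewrite neq_ltn => /orP[] ij.
    have ji : i.+2%:R <= j.+1%:R :> R by rewrite ler_nat ltnS.
    by have := lt_le_trans ti (le_trans ji jt); rewrite ltxx.
  have ji : j.+2%:R <= i.+1%:R :> R by rewrite ler_nat ltnS.
  by have := lt_le_trans tj (le_trans ji it); rewrite ltxx.
Qed.

Let cell_measure k : lebesgue_measure (cell k) = 1%E.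
Proof.
rewrite /cell lebesgue_measure_itv/= lte_fin ltr_nat ltnSn -EFinB.
by rewrite -[k.+2%:R]natr1 addrAC subrr add0r.
Qed.

Let cell_ge1 k t : cell k t -> 1 <= t.
Proof.
rewrite /cell/= in_itv/= => /andP[kt _]; apply: le_trans kt.
by rewrite ler1n.
Qed.

Lemma sum_le_integral :
  (\sum_(k <oo) (g k.+2%:R)%:E <=
   \int[lebesgue_measure]_(t in `[1%R, +oo[) (g t)%:E)%E.
Proof.
rewrite integral_eq_sum_cells; apply: lee_nneseries => [k _ _|k _].
  by rewrite lee_fin g0// ler1n.
rewrite -[leLHS]mule1 -(cell_measure k).
apply: cst_mul_measure_le_integral; try exact: measurable_itv; [by []|..].
- by rewrite g0// ler1n.
- by apply: measurable_funS mg => // t /cell_ge1 /=; rewrite in_itv/= andbT.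
- by move=> t /cell_ge1 t1; rewrite lee_fin g0.
- move=> t /[dup] /cell_ge1 t1; rewrite /cell/= in_itv/= => /andP[_ /ltW tk].
  by rewrite lee_fin gni.
Qed.

Lemma integral_le_sum :
  (\int[lebesgue_measure]_(t in `[1%R, +oo[) (g t)%:E
   <= \sum_(k <oo) (g k.+1%:R)%:E)%E.
Proof.
rewrite integral_eq_sum_cells; apply: lee_nneseries => [k _ _|k _].
  by apply: integral_ge0 => t /cell_ge1 t1; rewrite lee_fin g0.
rewrite -[leRHS]mule1 -(cell_measure k) -integral_cst; last exact: measurable_itv.
apply: ge0_le_integral; [exact: measurable_itv|..|by []|].
- by move=> t /cell_ge1 t1; rewrite lee_fin g0.
- by apply: measurable_funS mg => // t /cell_ge1 /=; rewrite in_itv/= andbT.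
- move=> t; rewrite /cell/= in_itv/= => /andP[tk _].
  by rewrite lee_fin gni// ler1n.
Qed.

End sum_integral_comparison.

(** * Growth along a rate function *)

Section growth_rate.
Context {R : realType} {d : measure_display} {Omega : measurableType d}.
Variable P : probability Omega R.
Variables (pi lambda : {measure set (measurableTypeR R) -> \bar R}).
Variables (xi tau zeta : nat -> {RV P >-> R}).
Hypothesis levy : levy_measure lambda.
Hypothesis points : supOU_points pi lambda xi tau zeta.
Let L x : R := fine (tail lambda x).
Hypothesis domvar : dominatedly_varying L.
Variable f : R -> R.
Hypothesis f_le : forall s t, 1 <= s -> s <= t -> f s <= f t.
Hypothesis f1 : 0 < f 1.
Hypothesis f_oo : f t @[t --> +oo] --> +oo.

Let f0 t : 1 <= t -> 0 < f t.
Proof. by move=> t1; apply: (lt_le_trans f1); exact: f_le. Qed.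

Let f_large (A : R) : exists N : nat, forall t, N%:R <= t -> A <= f t.
Proof.
have /cvgryPge/(_ A) [M [_ MA]] := f_oo.
exists (Num.truncn (Num.max M 0)).+1 => t Nt; apply: MA.
by rewrite (lt_le_trans _ Nt)// (le_lt_trans _ (truncnS_gt _))// le_max lexx.
Qed.

Section convergent_case.
Hypothesis m0 : (moment pi 0 < +oo)%E.
Hypothesis m1 : (moment pi (-1) < +oo)%E.
Hypothesis small : (\int[lambda]_(z in `]0%R, 1%R]) z%:E < +oo)%E.
Variable c : R.
Hypothesis c1 : 1 < c.
Hypothesis ratio :
  (limf_esup (fun r => (L (c * r) / L r)%:E) +oo%R < 1)%E.
Hypothesis fsum : (\sum_(k <oo) (L (f k.+2%:R))%:E < +oo)%E.

Let L0 r : 0 < r -> 0 <= L r.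
Proof. by case: domvar => _ Lpos _ /Lpos/ltW. Qed.

(** The grid point r = r0 c^l is the largest one below e f(n) / C0, hence at
    least e f(n) / (C0 c), and L(r) <= B L(f(n)) by dominated variation. *)
Lemma supOU_unit_interval_exceedance (e : R) : 0 < e ->
  exists B, 0 <= B /\ exists T : nat, forall n : nat, (T <= n)%N ->
    exists2 E : set Omega, measurable E /\ (P E <= (B * L (f n%:R))%:E)%E &
      forall w u, ~ E w -> n%:R <= u < n%:R + 1 ->
        (supOU xi tau zeta u w <= (e * f u)%:E)%E.
Proof.
move=> e0; have c0 : 0 < c by apply: lt_trans c1.
have [C0 [C1 [r0 [C00 C10 r00 H]]]] :=
  supOU_unit_interval_tail levy points m0 m1 small domvar c1 ratio.
pose del := e / C0.
have del0 : 0 < del by rewrite divr_gt0.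
have K0 : 0 < c / del by rewrite divr_gt0.
have [kap /andP[kap0 _] [r1 r10 Hkap]] := dominatedly_varying_scale K0 domvar.
have [Lni _ _] := domvar.
exists (C1 / kap); split; first by rewrite divr_ge0// ltW.
have [T1 HT1] := f_large (Num.max (r0 * c) (r1 * c) / del).
exists T1.+1 => n Tn.
have n1 : 1 <= n%:R :> R by rewrite ler1n (leq_trans _ Tn).
have : Num.max (r0 * c) (r1 * c) <= del * f n%:R.
  by rewrite [leRHS]mulrC -ler_pdivrMr// HT1// ler_nat ltnW.
rewrite ge_max => /andP[v0 v1].
have r0v : r0 <= del * f n%:R.
  by apply: le_trans v0; rewrite ler_peMr// ltW.
have [l /andP[ll lu]] := band_exists c1 r00 r0v.
have l0 : (0 < l)%N.
  case: l {lu} ll => // ; rewrite expr1 ltr_pdivrMr// => ll.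
  by have := le_lt_trans v0 ll; rewrite ltxx.
have [E [mE PE] HE] := H n%:R l l0.
have cl : r0 * c ^+ l <= del * f n%:R by rewrite -ler_pdivlMr// exprn_gt0.
exists E; first split=> //.
  apply: (le_trans PE); rewrite lee_fin -mulrA ler_wpM2l//.
  rewrite ler_pdivlMl//.
  have dl : del * f n%:R / c <= r0 * c ^+ l.
    rewrite ler_pdivrMr// -[leRHS]mulrA -exprSr -ler_pdivrMr ?exprn_gt0//.
    exact: ltW.
  apply: (@le_trans _ _ (kap * L (del * f n%:R / c))).
    by rewrite ler_pM2l// Lni// divr_gt0// mulr_gt0// f0.
  have -> : f n%:R = c / del * (del * f n%:R / c).
    by field; rewrite !gt_eqF.
  rewrite [X in L (X / c)](_ : _ = del * f n%:R); last by field; rewrite !gt_eqF.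
  by apply: Hkap; rewrite ler_pdivlMr.
move=> w u nE /andP[nu un].
apply: (le_trans (HE _ u nE _)); first by rewrite nu un.
rewrite lee_fin; apply: (@le_trans _ _ (C0 * (del * f n%:R))).
  by rewrite ler_pM2l.
rewrite /del mulrA [C0 * _]mulrC divfK ?gt_eqF// ler_pM2l//.
exact: f_le.
Qed.

Lemma supOU_eventually_le (e : R) : 0 < e ->
  {ae P, forall w, exists M : R, forall u, M < u ->
    (supOU xi tau zeta u w <= (e * f u)%:E)%E}.
Proof.
move=> e0; have [B [B0 [T HT]]] := supOU_unit_interval_exceedance e0.
pose T2 := T.+2.
have /choice [E HE] : forall k, exists E : set Omega,
   [/\ measurable E, (P E <= (B * L (f (k + T2)%:R))%:E)%E &
      forall w u, ~ E w -> (k + T2)%:R <= u < (k + T2)%:R + 1 ->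
        (supOU xi tau zeta u w <= (e * f u)%:E)%E].
  move=> k; have [|E [mE PE] HE] := HT (k + T2)%N.
    by rewrite (leq_trans _ (leq_addl _ _))// /T2 ltnW.
  by exists E.
exists (lim_sup_set E); split.
- by apply: bigcapT_measurable => k; apply: bigcup_measurable => j _; case: (HE j).
- apply: lim_sup_set_cvg0; first by move=> k; case: (HE k).
  apply: (@le_lt_trans _ _ (B%:E * \sum_(k <oo) (L (f k.+2%:R))%:E)%E); last first.
    by rewrite lte_mul_pinfty.
  have Lf k : (0 <= (L (f k.+2%:R))%:E)%E by rewrite lee_fin L0// f0// ler1n.
  rewrite -nneseriesZl//.
  apply: (@le_trans _ _ (\sum_(k <oo) (B%:E * (L (f (k + T).+2%:R))%:E))%E).
    apply: lee_nneseries => // k _.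
    by case: (HE k) => _; rewrite /T2 !addnS.
  rewrite (nneseries_addn (f := fun k => (B%:E * (L (f k.+2%:R))%:E)%E)); last first.
    by move=> k; rewrite mule_ge0.
  rewrite [leRHS](nneseries_split 0 T); last by move=> k _; rewrite mule_ge0.
  by rewrite add0n leeDr// sume_ge0// => k _; rewrite mule_ge0.
move=> w /= nw k _; apply: contrapT => notin; apply: nw.
exists (k + T2)%:R => u Mu.
have u0 : 0 <= u by apply: le_trans (ltW Mu).
have jk : (k + T2 <= Num.truncn u)%N by rewrite truncn_ge_nat// ltW.
pose j := (Num.truncn u - T2)%N.
have jT : (j + T2)%N = Num.truncn u by rewrite subnK// (leq_trans (leq_addl _ _) jk).
have [_ _ Ej] := HE j; apply: (Ej w u); last first.
  by rewrite jT natr1 truncn_le u0 truncnS_gt.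
move=> Ejw; apply: notin; exists j => //=.
by rewrite leq_subRL ?[(T2 + _)%N]addnC// (leq_trans (leq_addl _ _) jk).
Qed.

End convergent_case.
Section divergent_case.
Hypothesis pi0 : pi `]0, +oo[%classic <> 0%E.
Hypothesis fsum : (\sum_(k <oo) (L (f k.+1%:R))%:E = +oo)%E.

(** The region z > K f(s) is replaced by a union of rectangles over unit time
    intervals, each cut off at the value of f at the right end, which is
    enough for the intensity to be infinite. *)
Lemma supOU_frequently_ge (K : R) (N : nat) : 0 < K ->
  {ae P, forall w, exists2 u, N%:R < u & ((K * f u)%:E <= supOU xi tau zeta u w)%E}.
Proof.
move=> K0.
have [_ Lpos _] := domvar.
have [kap /andP[kap0 _] [r1 r10 Hkap]] := dominatedly_varying_scale K0 domvar.
have [N1 HN1] := f_large r1.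
pose n := (N + N1).+1.
pose rect j : set (measurableTypeR R * measurableTypeR R * measurableTypeR R) :=
  ([set: measurableTypeR R] `*` `](n + j)%:R, (n + j).+1%:R]%classic) `*`
  `]K * f (n + j).+1%:R, +oo[%classic.
have mstrip j : measurable ([set: measurableTypeR R] `*`
    (`](n + j)%:R, (n + j).+1%:R]%classic : set (measurableTypeR R))).
  by apply: measurableX => //; exact: measurable_itv.
have mrect j : measurable (rect j).
  by apply: measurableX => //; exact: measurable_itv.
have fj j : r1 <= f (n + j).+1%:R.
  apply: HN1; rewrite ler_nat (leq_trans (leq_addl N N1))//.
  by rewrite (leq_trans (leqnSn _))// (leq_trans (leq_addr j n)).
have fj0 j : 0 < f (n + j).+1%:R by apply: lt_le_trans (fj j).
have [nu [nuE nuX]] := product_measure_exists (pi \x lebesgue_measure)%E (levy_sigma_finite levy).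
have piT : (0 < pi setT)%E.
  rewrite lt0e measure_ge0 andbT; apply/eqP => piT0; apply: pi0.
  by apply/eqP; rewrite -measure_le0 -piT0; apply: le_measure; rewrite ?inE.
have nurect j : nu (rect j) = (pi setT * (L (K * f (n + j).+1%:R))%:E)%E.
  have strip : ((pi \x lebesgue_measure)%E ([set: measurableTypeR R] `*`
      (`](n + j)%:R, (n + j).+1%:R]%classic : set (measurableTypeR R))) = pi setT)%E.
    transitivity (pi setT * lebesgue_measure (`](n + j)%:R, (n + j).+1%:R]%classic : set R))%E.
      by apply: product_measure1E => //; exact: measurable_itv.
    rewrite lebesgue_measure_itv/= lte_fin ltr_nat ltnSn -EFinB.
    by rewrite -[(n + j).+1%:R]natr1 addrAC subrr add0r mule1.
  rewrite /rect nuX; [|exact: mstrip|exact: measurable_itv].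
  congr (_ * _)%E; first exact: strip.
  rewrite fineK//; apply: (tail_fin_num levy).
  by rewrite mulr_gt0.
have nuA : nu (\bigcup_j rect j) = +oo%E.
  rewrite measure_semi_bigcup//; last 2 first.
  - apply/trivIsetP => i j _ _ ij; apply/seteqP; split => // -[[x s] z].
    rewrite /rect/= => -[[[_ +] _] [[_ +] _]]; rewrite /= !in_itv/= => /andP[i1 i2] /andP[j1 j2].
    move: ij; rewrite neq_ltn => /orP[] ij.
      have : (n + i).+1%:R <= (n + j)%:R :> R by rewrite ler_nat -addnS leq_add2l.
      by move=> /(le_trans i2)/(lt_le_trans j1); rewrite ltxx.
    have : (n + j).+1%:R <= (n + i)%:R :> R by rewrite ler_nat -addnS leq_add2l.
    by move=> /(le_trans j2)/(lt_le_trans i1); rewrite ltxx.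
  - exact: bigcupT_measurable.
  under eq_eseriesr do rewrite nurect.
  have [p p0 ppi] : exists2 p : R, 0 < p & (p%:E <= pi setT)%E.
    move: piT; case: (pi setT) => [p|_|//]; first by rewrite lte_fin => p0; exists p.
    by exists 1; rewrite ?leey.
  have a0 k : (0 <= (L (f k.+1%:R))%:E)%E.
    by rewrite lee_fin ltW// Lpos// f0// ler1n.
  have tailsum : (\sum_(j <oo) (L (f (j + n).+1%:R))%:E = +oo)%E.
    rewrite (nneseries_addn (f := fun k => (L (f k.+1%:R))%:E))//.
    move: fsum; rewrite (nneseries_split 0 n)// add0n sumEFin.
    by case: (\sum_(n <= k <oo) _)%E.
  apply/eqP; rewrite -leye_eq.
  apply: (@le_trans _ _ (\sum_(j <oo) ((p * kap)%:E * (L (f (j + n).+1%:R))%:E))%E).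
    by rewrite nneseriesZl// tailsum gt0_muley// lte_fin mulr_gt0.
  apply: lee_nneseries => [j _ _|j _].
    by rewrite mule_ge0// lee_fin ltW// mulr_gt0.
  rewrite EFinM -muleA; apply: lee_pmul => //.
  - by rewrite lee_fin ltW.
  - by rewrite mule_ge0// lee_fin ltW.
  - by rewrite -EFinM lee_fin addnC Hkap.
have [_ [_ _ infinite _]] := points.
have mA : measurable (\bigcup_j rect j) by exact: bigcupT_measurable.
have := infinite _ mA (etrans (esym (nuE _)) nuA).
apply: filterS => w muw.
have [k [j _ [[_ /= tauk] zk]]] : exists k, (\bigcup_j rect j) (xi k w, tau k w, zeta k w).
  apply: contrapT => /forallNP nok.
  have : (\sum_(k <oo) \d_((xi k w, tau k w, zeta k w) :
    measurableTypeR R * measurableTypeR R * measurableTypeR R)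
    (\bigcup_j rect j) = +oo :> \bar R)%E := muw.
  rewrite eseries0// => k _ _.
  by rewrite diracE memNset.
move: tauk zk; rewrite /= !in_itv/= andbT => /andP[tau1 tau2] zk.
have tau_ge1 : 1 <= tau k w.
  by apply: le_trans (ltW tau1); rewrite ler1n /n addSn.
exists (tau k w).
  apply: le_lt_trans tau1; rewrite ler_nat /n addSn ltnW// ltnS -addnA leq_addr//.
apply: (@le_trans _ _ (zeta k w)%:E).
  rewrite lee_fin; apply: le_trans (ltW zk).
  by rewrite ler_pM2l//; exact: f_le.
have [pos _] := points.
have term0 i : (0 <= (expR (- xi i w * (tau k w - tau i w)) * zeta i w)%:E)%E.
  by rewrite lee_fin mulr_ge0 ?expR_ge0// ltW//; case: (pos i w).
rewrite /supOU (nneseriesD1 (n := k))//.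
rewrite subrr mulr0 expR0 mul1r leeDl//.
exact: nneseries_ge0.
Qed.

End divergent_case.
End growth_rate.

Theorem corollary2 (R : realType) (d : measure_display)
    (Omega : measurableType d) (P : probability Omega R)
    (pi lambda : {measure set (measurableTypeR R) -> \bar R})
    (xi tau zeta : nat -> {RV P >-> R}) (c : R) (f : R -> R) :
  on_pos_half_line pi ->
  pi `]0, +oo[%classic <> 0%E ->
  (moment pi (-1) < +oo)%E ->
  levy_measure lambda ->
  (\int[lambda]_(z in `]1%R, +oo[) (ln z)%:E < +oo)%E ->
  supOU_points pi lambda xi tau zeta ->
  (\int[lambda]_(z in `]0%R, 1%R]) z%:E < +oo)%E ->
  (moment pi 0 < +oo)%E ->
  dominatedly_varying (fun x => fine (tail lambda x)) ->
  1 < c ->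
  (limf_esup
     (fun r => (fine (tail lambda (c * r)) / fine (tail lambda r))%:E) +oo%R
   < 1)%E ->
  differentiable_within `[1, +oo[%classic f ->
  {in `[1, +oo[ &, {homo f : s t / s < t}} ->
  f t @[t --> +oo] --> +oo ->
  0 < f 1 ->
  submultiplicative_on `[f 1, +oo[%classic ('pinv_(fun=> 0) `[1, +oo[%classic f) ->
  ((\int[lebesgue_measure]_(t in `[1%R, +oo[) tail lambda (f t) < +oo)%E ->
   {ae P, forall w,
     limf_esup (fun t => supOU xi tau zeta t w * (f t)^-1%:E)%E +oo%R
     = 0%E}) /\
  ((\int[lebesgue_measure]_(t in `[1%R, +oo[) tail lambda (f t) = +oo)%E ->
   {ae P, forall w,
     limf_esup (fun t => supOU xi tau zeta t w * (f t)^-1%:E)%E +oo%R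
     = +oo%E}).
Proof.
move=> _ pi0 m1 levy _ points small m0 domvar c1 ratio _ f_incr f_oo f1 _.
have f_le s t : 1 <= s -> s <= t -> f s <= f t.
  rewrite [s <= t]le_eqVlt => s1 /predU1P[->//|st].
  by apply: ltW; apply: f_incr; rewrite ?in_itv/= ?andbT// (le_trans s1)// ltW.
have f0 t : 1 <= t -> 0 < f t by move=> t1; apply: (lt_le_trans f1); exact: f_le.
have [Lni Lpos _] := domvar.
pose g t := fine (tail lambda (f t)).
have g0 t : 1 <= t -> 0 <= g t by move=> /f0/Lpos/ltW.
have gni s t : 1 <= s -> s <= t -> g t <= g s.
  by move=> s1 st; apply: Lni; [exact: f0|exact: f_le].
have gE : (\int[lebesgue_measure]_(t in `[1%R, +oo[) tail lambda (f t) =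
    \int[lebesgue_measure]_(t in `[1%R, +oo[) (g t)%:E)%E.
  apply: eq_integral => t /set_mem/=; rewrite in_itv/= andbT => t1.
  by rewrite fineK// (tail_fin_num levy)// f0.
rewrite gE; split=> [gfin|ginf].
- have ev (i : nat) : {ae P, forall w, exists M : R, forall u, M < u ->
      (supOU xi tau zeta u w <= (i.+1%:R^-1 * f u)%:E)%E}.
    apply: (supOU_eventually_le levy points domvar f_le f1 f_oo m0 m1 small c1 ratio) => //.
    exact: le_lt_trans (sum_le_integral g0 gni) gfin.
  have /ae_foralln := ev; apply: filterS => w evw.
  apply: limf_esup_eq0 => e e0.
  have [M HM] := evw (Num.truncn e^-1).
  exists (Num.max M 1) => u; rewrite gt_max => /andP[Mu u1].
  have fu0 := f0 u (ltW u1).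
  apply/andP; split.
    rewrite mule_ge0 ?lee_fin ?invr_ge0 ?(ltW fu0)//.
    apply: nneseries_ge0 => k _ _; rewrite lee_fin mulr_ge0 ?expR_ge0// ltW//.
    by case: points => pos _; case: (pos k w).
  rewrite muleC lee_pdivrMl// -EFinM; apply: (le_trans (HM u Mu)).
  rewrite lee_fin mulrC ler_pM2l//.
  by rewrite invf_ple ?posrE// ltW// truncnS_gt.
- have sinf : (\sum_(k <oo) (g k.+1%:R)%:E = +oo)%E.
    by apply/eqP; rewrite -leye_eq -ginf; exact: integral_le_sum.
  have freq (i N : nat) : {ae P, forall w, exists2 u, N%:R < u &
      ((i.+1%:R * f u)%:E <= supOU xi tau zeta u w)%E}.
    exact: (supOU_frequently_ge levy points domvar f_le f1 f_oo pi0 sinf).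
  have /ae_foralln := fun i => ae_foralln (freq i); apply: filterS => w freqw.
  apply: limf_esup_eqy => K M.
  have [u Nu Ku] := freqw (Num.truncn K) (Num.truncn (Num.max M 1)).+1.
  have Mu : Num.max M 1 < u by apply: lt_trans (truncnS_gt _) Nu.
  move: Mu; rewrite gt_max => /andP[Mu u1]; exists u => //.
  have fu0 := f0 u (ltW u1).
  rewrite muleC lee_pdivlMl// -EFinM; apply: le_trans Ku.
  by rewrite lee_fin mulrC ler_pM2r// ltW// truncnS_gt.
Qed.
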